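(* Every Harish-Chandra module $V$ of the Lie algebra $\widetilde{L}$ is a generalized highest weight module or a uniformly bounded module.
   Context: All vector spaces are over $\mathbb{C}$; $\mathbb{Z}_+$ is the set of nonnegative integers. Let $\Gamma=\mathbb{Z}\mathbf{e}_1+\mathbb{Z}\mathbf{e}_2=\mathbb{Z}^2$ with $\mathbf{e}_1=(1,0)$, $\mathbf{e}_2=(0,1)$. For $\mathbf{a}=(a_1,a_2),\mathbf{b}=(b_1,b_2)\in\Gamma$ put $\det\binom{\mathbf{a}}{\mathbf{b}}=a_1b_2-a_2b_1$. $L$ is the Lie algebra with basis $\{t^{\mathbf{m}},E(\mathbf{m}),K_1,K_2,K_3,K_4\mid \mathbf{m}\in\Gamma\setminus\{\mathbf{0}\}\}$ and brackets: $K_i$ central; $[t^{\mathbf{m}},t^{\mathbf{n}}]=0$; $[t^{\mathbf{m}},E(\mathbf{n})]=\det\binom{\mathbf{n}}{\mathbf{m}}t^{\mathbf{m}+\mathbf{n}}+\delta_{\mathbf{m}+\mathbf{n},\mathbf{0}}h(\mathbf{m})$; $[E(\mathbf{m}),E(\mathbf{n})]=\det\binom{\mathbf{n}}{\mathbf{m}}E(\mathbf{m}+\mathbf{n})+\delta_{\mathbf{m}+\mathbf{n},\mathbf{0}}f(\mathbf{m})$, where $h(\mathbf{m})=m_1K_1+m_2K_2$, $f(\mathbf{m})=m_1K_3+m_2K_4$ for $\mathbf{m}=(m_1,m_2)$, with the convention $E(\mathbf{0})=t^{\mathbf{0}}=0$. $\widetilde{L}=L\oplus\mathbb{C}d_1\oplus\mathbb{C}d_2$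 with $[d_i,E(\mathbf{m})]=m_iE(\mathbf{m})$, $[d_i,t^{\mathbf{m}}]=m_it^{\mathbf{m}}$, $[d_i,K_j]=0$, $[d_1,d_2]=0$. A weight module of $\widetilde{L}$ is a module $V=\bigoplus_{\boldsymbol\lambda\in\mathbb{C}^6}V_{\boldsymbol\lambda}$ with $V_{\boldsymbol\lambda}=\{v\mid d_iv=\lambda_iv,\ K_jv=\lambda_{j+2}v,\ i=1,2,\ j=1,\dots,4\}$. A Harish-Chandra module is an irreducible weight module all of whose weight spaces are finite dimensional. A weight module is uniformly bounded if there is a positive integer $N$ with $\dim V_{\boldsymbol\lambda}\le N$ for all $\boldsymbol\lambda$. A weight module $V$ is a generalized highest weight (GHW) module if there are a $\mathbb{Z}$-basis $\{\mathbf{b}_1,\mathbf{b}_2\}$ of $\Gamma$ and a nonzero weight vector $v$ with $V=\mathcal{U}(\widetilde{L})v$ and $E(\mathbf{m})v=t^{\mathbf{m}}v=0$ for all $\mathbf{m}\in\mathbb{Z}_+\mathbf{b}_1+\mathbb{Z}_+\mathbf{b}_2$. *)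

(* Defs.v *)
From HB Require Import structures.
From mathcomp Require Import all_boot all_order all_algebra.
From mathcomp Require Import finmap monalg complex.
From mathcomp Require Import classical_sets reals.
From mathcomp Require Import ring.

Set Implicit Arguments.
Unset Strict Implicit.
Unset Printing Implicit Defensive.

Import Order.TTheory GRing.Theory Num.Theory.
Local Open Scope ring_scope.
Local Open Scope classical_set_scope.

HB.mixin Record isLieAlgebra (F : fieldType) L of GRing.Lmodule F L := {
  lie_bracket : {bilinear L -> L -> L};
  lie_alternating : forall x, lie_bracket x x = 0;
  lie_jacobi : forall x y z,
    lie_bracket x (lie_bracket y z) + lie_bracket y (lie_bracket z x)
      + lie_bracket z (lie_bracket x y) = 0 }.

#[short(type="lieAlgType")]
HB.structure Definition LieAlgebra (F : fieldType) :=
  { L of GRing.Lmodule F L & isLieAlgebra F L }.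

Record lie_module (F : fieldType) (L : lieAlgType F) (V : lmodType F) :=
  LieModule {
    act :> {bilinear L -> V -> V};
    act_bracket : forall x y v,
      act (lie_bracket x y) v = act x (act y v) - act y (act x v) }.

Section LinearExtension.
Variables (F : fieldType) (K : choiceType) (M : lmodType F).
Implicit Types (f : K -> M) (x y : {malg F[K]}).

Definition malg_lin f x : M := \sum_(k <- msupp x) x@_k *: f k.

Lemma malg_linEw f (d : {fset K}) x : (msupp x `<=` d)%fset ->
  malg_lin f x = \sum_(k <- d) x@_k *: f k.
Proof.
move=> le; rewrite /malg_lin (big_fset_incl _ le) => //= k kd /mcoeff_outdom ->.
by rewrite scale0r.
Qed.

Lemma malg_lin_is_linear f : linear (malg_lin f).
Proof.
move=> a x y; pose d := (msupp x `|` msupp y)%fset.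
rewrite (@malg_linEw _ d x) ?fsubsetUl // (@malg_linEw _ d y) ?fsubsetUr //.
rewrite (@malg_linEw _ d); last first.
  apply: (fsubset_trans (msuppD_le _ _)); apply: fsetSU; exact: msuppZ_le.
rewrite scaler_sumr -big_split /=; apply: eq_bigr => k _.
by rewrite mcoeffD mcoeffZ scalerDl scalerA.
Qed.

HB.instance Definition _ f :=
  GRing.isLinear.Build F {malg F[K]} M _ (malg_lin f) (malg_lin_is_linear f).

Lemma malg_linU f k : malg_lin f << k >> = f k.
Proof.
by rewrite (malg_linEw f msuppU_le) big_seq_fset1 mcoeffUU scale1r.
Qed.

Lemma malg_lin_fun a f g x :
  malg_lin (fun k => a *: f k + g k) x = a *: malg_lin f x + malg_lin g x.
Proof.
rewrite /malg_lin scaler_sumr -big_split /=; apply: eq_bigr => k _.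
by rewrite scalerDr !scalerA mulrC.
Qed.

Lemma malg_ind (P : {malg F[K]} -> Prop) :
  P 0 -> (forall x y, P x -> P y -> P (x + y)) ->
  (forall a k, P (a *: << k >>)) -> forall x, P x.
Proof.
move=> P0 PD PU x; rewrite [x]monalgE; apply: big_ind => // k _.
suff -> : << x@_k *g k >> = x@_k *: << k >> :> {malg F[K]} by [].
by apply/malgP => j; rewrite mcoeffZ !mcoeffU mulr_natr.
Qed.

End LinearExtension.

Notation Gamma := (int * int)%type.

Definition gdet (a b : Gamma) : int := a.1 * b.2 - a.2 * b.1.

Definition gcoord (i : 'I_2) (m : Gamma) : int := if i == ord0 then m.1 else m.2.

Definition nzGamma := {m : Gamma | m != 0}.

Inductive ltilde_basis :=
  | Bt of nzGamma
  | BE of nzGamma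
  | BK of 'I_4
  | Bd of 'I_2.

Definition ltilde_basis_enc (b : ltilde_basis) : nzGamma + nzGamma + 'I_4 + 'I_2 :=
  match b with
  | Bt m => inl (inl (inl m))
  | BE m => inl (inl (inr m))
  | BK j => inl (inr j)
  | Bd i => inr i
  end.

Definition ltilde_basis_dec (c : nzGamma + nzGamma + 'I_4 + 'I_2) : ltilde_basis :=
  match c with
  | inl (inl (inl m)) => Bt m
  | inl (inl (inr m)) => BE m
  | inl (inr j) => BK j
  | inr i => Bd i
  end.

Lemma ltilde_basis_encK : cancel ltilde_basis_enc ltilde_basis_dec.
Proof. by case. Qed.

HB.instance Definition _ := Choice.copy ltilde_basis (can_type ltilde_basis_encK).

(* {malg F[B]} is used only as the free F-module on B. *)
Definition Ltilde (F : fieldType) := {malg F[ltilde_basis]}.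

HB.instance Definition _ (F : fieldType) := GRing.Lmodule.on (Ltilde F).

HB.lock Definition Lbase (F : fieldType) (b : ltilde_basis) : Ltilde F := << b >>.

Section LtildeBasis.
Variable F : fieldType.
Local Notation L := (Ltilde F).

(* Defined on all of Gamma, with the convention t^0 = E(0) = 0. *)
Definition Lt (m : Gamma) : L :=
  if insub m is Some m' then Lbase F (Bt m') else 0.

Definition LE (m : Gamma) : L :=
  if insub m is Some m' then Lbase F (BE m') else 0.

Definition LK (j : 'I_4) : L := Lbase F (BK j).

Definition Ld (i : 'I_2) : L := Lbase F (Bd i).

Definition Lh (m : Gamma) : L :=
  m.1%:~R *: LK (@Ordinal 4 0 isT) + m.2%:~R *: LK (@Ordinal 4 1 isT).

Definition Lf (m : Gamma) : L :=
  m.1%:~R *: LK (@Ordinal 4 2 isT) + m.2%:~R *: LK (@Ordinal 4 3 isT).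

Definition br_tE (m n : Gamma) : L :=
  (gdet n m)%:~R *: Lt (m + n) + (if m + n == 0 then Lh m else 0).

Definition br_EE (m n : Gamma) : L :=
  (gdet n m)%:~R *: LE (m + n) + (if m + n == 0 then Lf m else 0).

Definition basis_bracket (x y : ltilde_basis) : L :=
  match x, y with
  | Bt m, BE n => br_tE (val m) (val n)
  | BE n, Bt m => - br_tE (val m) (val n)
  | BE m, BE n => br_EE (val m) (val n)
  | Bd i, Bt m => (gcoord i (val m))%:~R *: Lt (val m)
  | Bt m, Bd i => - ((gcoord i (val m))%:~R *: Lt (val m))
  | Bd i, BE m => (gcoord i (val m))%:~R *: LE (val m)
  | BE m, Bd i => - ((gcoord i (val m))%:~R *: LE (val m))
  | _, _ => 0
  end.

End LtildeBasis.

HB.lock Definition Lbracket (F : fieldType) (x y : Ltilde F) : Ltilde F :=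
  malg_lin (fun i => malg_lin (basis_bracket F i) y) x.

Section LtildeBracket.
Variable F : fieldType.
Local Notation L := (Ltilde F).
Local Notation Lbase := (Lbase F).
Local Notation Lh := (Lh F).
Local Notation Lf := (Lf F).
Local Notation LK := (LK F).
Local Notation LE := (LE F).
Local Notation Lt := (Lt F).
Local Notation Ld := (Ld F).
Local Notation br_tE := (br_tE F).
Local Notation br_EE := (br_EE F).
Local Notation basis_bracket := (basis_bracket F).
Local Notation Lbracket := (@Lbracket F).

Lemma Lbracket_is_bilinear : bilinear_for
  (GRing.Scale.Law.clone _ _ *:%R _) (GRing.Scale.Law.clone _ _ *:%R _) Lbracket.
Proof.
split=> [y|x] a u v /=; rewrite !unlock; first by rewrite linearP.
rewrite -malg_lin_fun; apply: eq_bigr => k _; congr (_ *: _).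
exact: malg_lin_is_linear.
Qed.

HB.instance Definition _ := bilinear_isBilinear.Build F L L L _ _ Lbracket
  Lbracket_is_bilinear.

Lemma LbracketDl x y z : Lbracket (x + y) z = Lbracket x z + Lbracket y z.
Proof. exact: linearDl. Qed.

Lemma LbracketDr x y z : Lbracket x (y + z) = Lbracket x y + Lbracket x z.
Proof. exact: linearDr. Qed.

Lemma LbracketZl a x y : Lbracket (a *: x) y = a *: Lbracket x y.
Proof. exact: linearZl_LR. Qed.

Lemma LbracketZr a x y : Lbracket x (a *: y) = a *: Lbracket x y.
Proof. exact: linearZr_LR. Qed.

Lemma LbracketNr x y : Lbracket x (- y) = - Lbracket x y.
Proof. exact: linearNr. Qed.

Lemma Lbracket0l x : Lbracket 0 x = 0.
Proof. exact: linear0l. Qed.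

Lemma Lbracket0r x : Lbracket x 0 = 0.
Proof. exact: linear0r. Qed.

Lemma LbracketUU i j : Lbracket (Lbase i) (Lbase j) = basis_bracket i j.
Proof. by rewrite !unlock !malg_linU. Qed.

Lemma Ltilde_ind (P : L -> Prop) :
  P 0 -> (forall x y, P x -> P y -> P (x + y)) ->
  (forall a k, P (a *: (Lbase k))) -> forall x, P x.
Proof. by move=> P0 PD PZ; apply: malg_ind => // a k; have := PZ a k; rewrite unlock. Qed.

Lemma Lt0 : Lt 0 = 0.
Proof. by rewrite /Lt insubF ?eqxx. Qed.

Lemma LE0 : LE 0 = 0.
Proof. by rewrite /LE insubF ?eqxx. Qed.

Lemma gdet0l m : gdet 0 m = 0.
Proof. by rewrite /gdet /= !mul0r subrr. Qed.

Lemma gdet0r m : gdet m 0 = 0.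
Proof. by rewrite /gdet /= !mulr0 subrr. Qed.

Lemma gdetC m n : gdet m n = - gdet n m.
Proof. by rewrite /gdet; ring. Qed.

Lemma LhN m : Lh (- m) = - Lh m.
Proof. by rewrite /Lh /= !mulrNz !scaleNr opprD. Qed.

Lemma LfN m : Lf (- m) = - Lf m.
Proof. by rewrite /Lf /= !mulrNz !scaleNr opprD. Qed.

Lemma Lbracket_tt m n : Lbracket (Lt m) (Lt n) = 0.
Proof.
rewrite /Lt; case: insubP => [m' _ _|_]; last by rewrite Lbracket0l.
by case: insubP => [n' _ _|_]; rewrite ?Lbracket0r // LbracketUU.
Qed.

Lemma br_tE0l n : br_tE 0 n = 0.
Proof. by rewrite /br_tE gdet0r scale0r add0r /Lh /= !scale0r addr0 if_same. Qed.

Lemma br_tE0r n : br_tE n 0 = 0.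
Proof.
rewrite /br_tE gdet0l scale0r add0r addr0.
by case: eqP => // ->; rewrite /Lh /= !scale0r addr0.
Qed.

Lemma br_EE0l n : br_EE 0 n = 0.
Proof. by rewrite /br_EE gdet0r scale0r add0r /Lf /= !scale0r addr0 if_same. Qed.

Lemma br_EE0r n : br_EE n 0 = 0.
Proof.
rewrite /br_EE gdet0l scale0r add0r addr0.
by case: eqP => // ->; rewrite /Lf /= !scale0r addr0.
Qed.

Lemma Lbracket_tE m n : Lbracket (Lt m) (LE n) =
  (gdet n m)%:~R *: Lt (m + n) + (if m + n == 0 then Lh m else 0).
Proof.
rewrite -/(br_tE m n) {1}/Lt; case: insubP => [m' _ <-|]; last first.
  by rewrite negbK => /eqP ->; rewrite Lbracket0l br_tE0l.
rewrite /LE; case: insubP => [n' _ <-|]; first by rewrite LbracketUU.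
by rewrite negbK => /eqP ->; rewrite Lbracket0r br_tE0r.
Qed.

Lemma Lbracket_EE m n : Lbracket (LE m) (LE n) =
  (gdet n m)%:~R *: LE (m + n) + (if m + n == 0 then Lf m else 0).
Proof.
rewrite -/(br_EE m n) {1}/LE; case: insubP => [m' _ <-|]; last first.
  by rewrite negbK => /eqP ->; rewrite Lbracket0l br_EE0l.
rewrite /LE; case: insubP => [n' _ <-|]; first by rewrite LbracketUU.
by rewrite negbK => /eqP ->; rewrite Lbracket0r br_EE0r.
Qed.

Lemma Lbracket_dt i m : Lbracket (Ld i) (Lt m) = (gcoord i m)%:~R *: Lt m.
Proof.
rewrite {1}/Lt; case: insubP => [m' _ <-|]; first by rewrite LbracketUU.
by rewrite negbK => /eqP ->; rewrite Lbracket0r Lt0 scaler0.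
Qed.

Lemma Lbracket_dE i m : Lbracket (Ld i) (LE m) = (gcoord i m)%:~R *: LE m.
Proof.
rewrite {1}/LE; case: insubP => [m' _ <-|]; first by rewrite LbracketUU.
by rewrite negbK => /eqP ->; rewrite Lbracket0r LE0 scaler0.
Qed.

Lemma Lbracket_dd i j : Lbracket (Ld i) (Ld j) = 0.
Proof. by rewrite LbracketUU. Qed.

Lemma Lbracket_Kl j x : Lbracket (LK j) x = 0.
Proof.
elim/Ltilde_ind: x => [|x y Hx Hy|a k]; first by rewrite Lbracket0r.
  by rewrite LbracketDr Hx Hy addr0.
by rewrite LbracketZr LbracketUU scaler0.
Qed.

Lemma basis_bracketC i j : basis_bracket i j = - basis_bracket j i.
Proof.
case: i j => [m|m|j|i] [n|n|k|l] /=; rewrite ?oppr0 ?opprK // /br_EE.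
rewrite opprD -scaleNr -mulrNz -gdetC [val n + _]addrC; congr (_ + _).
by case: eqP => [/(canRL (addrK _))|]; rewrite ?oppr0 // sub0r => ->; rewrite LfN.
Qed.

Lemma LbracketC x y : Lbracket x y = - Lbracket y x.
Proof.
elim/Ltilde_ind: x => [|x x' Hx Hx'|a k]; first by rewrite Lbracket0l Lbracket0r oppr0.
  by rewrite LbracketDl LbracketDr Hx Hx' opprD.
rewrite LbracketZl LbracketZr -scalerN; congr (_ *: _).
elim/Ltilde_ind: y => [|y y' Hy Hy'|b l]; first by rewrite Lbracket0l Lbracket0r oppr0.
  by rewrite LbracketDl LbracketDr Hy Hy' opprD.
by rewrite LbracketZl LbracketZr -scalerN !LbracketUU basis_bracketC.
Qed.

Lemma Gamma_add_self (m : Gamma) : m + m = 0 -> m = 0.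
Proof.
case: m => a b [/eqP + /eqP].
by rewrite -!mulr2n !mulrn_eq0 /= => /eqP -> /eqP ->.
Qed.

Lemma basis_bracket_alt i : basis_bracket i i = 0.
Proof.
case: i => [m|m|j|i] //=; rewrite /br_EE /gdet mulrC subrr scale0r add0r.
case: eqP => // m2; by case/eqP: (valP m); exact: Gamma_add_self.
Qed.

Lemma Lbracket_alt x : Lbracket x x = 0.
Proof.
elim/Ltilde_ind: x => [|x y Hx Hy|a k]; first by rewrite Lbracket0l.
  by rewrite LbracketDl !LbracketDr Hx Hy add0r addr0 LbracketC addNr.
by rewrite LbracketZl LbracketZr LbracketUU basis_bracket_alt !scaler0.
Qed.


Lemma Lbracket_Kr x j : Lbracket x (LK j) = 0.
Proof. by rewrite LbracketC Lbracket_Kl oppr0. Qed.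

Lemma Lbracket_hr x m : Lbracket x (Lh m) = 0.
Proof. by rewrite /Lh LbracketDr !LbracketZr !Lbracket_Kr !scaler0 addr0. Qed.

Lemma Lbracket_fr x m : Lbracket x (Lf m) = 0.
Proof. by rewrite /Lf LbracketDr !LbracketZr !Lbracket_Kr !scaler0 addr0. Qed.

Lemma Lbracket_tEE m n p : Lbracket (Lt m) (Lbracket (LE n) (LE p)) =
  (gdet p n * gdet (n + p) m)%:~R *: Lt (m + n + p) +
  (if m + n + p == 0 then (gdet p n)%:~R *: Lh m else 0).
Proof.
rewrite Lbracket_EE LbracketDr LbracketZr Lbracket_tE.
have -> : Lbracket (Lt m) (if n + p == 0 then Lf n else 0) = 0.
  by case: ifP; rewrite ?Lbracket0r ?Lbracket_fr.
by rewrite addr0 scalerDr scalerA intrM addrA; case: ifP; rewrite ?scaler0.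
Qed.

Lemma Lbracket_EtE m n p : Lbracket (LE m) (Lbracket (Lt n) (LE p)) =
  - ((gdet p n * gdet m (n + p))%:~R *: Lt (m + n + p) +
     (if m + n + p == 0 then (gdet p n)%:~R *: Lh (n + p) else 0)).
Proof.
rewrite Lbracket_tE LbracketDr LbracketZr.
rewrite [Lbracket (LE m) (Lt _)]LbracketC Lbracket_tE.
have -> : Lbracket (LE m) (if n + p == 0 then Lh n else 0) = 0.
  by case: ifP; rewrite ?Lbracket0r ?Lbracket_hr.
have -> : n + p + m = m + n + p by rewrite addrC addrA.
by rewrite addr0 scalerN scalerDr scalerA intrM; case: ifP; rewrite ?scaler0.
Qed.

Lemma Lbracket_EEE m n p : Lbracket (LE m) (Lbracket (LE n) (LE p)) =
  (gdet p n * gdet (n + p) m)%:~R *: LE (m + n + p) +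
  (if m + n + p == 0 then (gdet p n)%:~R *: Lf m else 0).
Proof.
rewrite Lbracket_EE LbracketDr LbracketZr Lbracket_EE.
have -> : Lbracket (LE m) (if n + p == 0 then Lf n else 0) = 0.
  by case: ifP; rewrite ?Lbracket0r ?Lbracket_fr.
by rewrite addr0 scalerDr scalerA intrM addrA; case: ifP; rewrite ?scaler0.
Qed.

Definition jac (x y z : L) : L :=
  Lbracket x (Lbracket y z) + Lbracket y (Lbracket z x) + Lbracket z (Lbracket x y).

Lemma jac_rot x y z : jac x y z = jac y z x.
Proof. by rewrite /jac -addrA addrC. Qed.

Lemma jac_swap x y z : jac x y z = - jac y x z.
Proof.
rewrite /jac [Lbracket y z]LbracketC [Lbracket z x]LbracketC.
rewrite [Lbracket x y]LbracketC !LbracketNr !opprD.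
by rewrite [- _ + - Lbracket y _]addrC.
Qed.

Lemma LhZ3 (a b c : int) m n p :
  a * m.1 + b * n.1 + c * p.1 = 0 -> a * m.2 + b * n.2 + c * p.2 = 0 ->
  a%:~R *: Lh m + b%:~R *: Lh n + c%:~R *: Lh p = 0.
Proof.
move=> e1 e2; rewrite /Lh !scalerDr !scalerA -!intrM.
rewrite [X in X + _]addrACA [LHS]addrACA -!scalerDl -!intrD.
by rewrite [X in X%:~R *: _]e1 [X in _ + X%:~R *: _]e2 !scale0r addr0.
Qed.

Lemma LfZ3 (a b c : int) m n p :
  a * m.1 + b * n.1 + c * p.1 = 0 -> a * m.2 + b * n.2 + c * p.2 = 0 ->
  a%:~R *: Lf m + b%:~R *: Lf n + c%:~R *: Lf p = 0.
Proof.
move=> e1 e2; rewrite /Lf !scalerDr !scalerA -!intrM.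
rewrite [X in X + _]addrACA [LHS]addrACA -!scalerDl -!intrD.
by rewrite [X in X%:~R *: _]e1 [X in _ + X%:~R *: _]e2 !scale0r addr0.
Qed.

Lemma jac_K j x y : jac (LK j) x y = 0.
Proof. by rewrite /jac !Lbracket_Kl Lbracket_Kr !Lbracket0r !addr0. Qed.

Lemma jac_ttt m n p : jac (Lt m) (Lt n) (Lt p) = 0.
Proof. by rewrite /jac !Lbracket_tt !Lbracket0r !addr0. Qed.

Lemma Lbracket_t_tE m n p : Lbracket (Lt m) (Lbracket (Lt n) (LE p)) = 0.
Proof.
rewrite Lbracket_tE LbracketDr LbracketZr Lbracket_tt scaler0 add0r.
by case: ifP; rewrite ?Lbracket0r ?Lbracket_hr.
Qed.

Lemma jac_Ett m n p : jac (LE m) (Lt n) (Lt p) = 0.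
Proof.
rewrite /jac Lbracket_tt Lbracket0r add0r [Lbracket (LE m) _]LbracketC.
by rewrite LbracketNr !Lbracket_t_tE oppr0 addr0.
Qed.

Lemma jac_tEE m n p : jac (Lt m) (LE n) (LE p) = 0.
Proof.
rewrite /jac [Lbracket (LE p) (Lt m)]LbracketC LbracketNr.
rewrite Lbracket_tEE !Lbracket_EtE opprK [n + m]addrC.
have -> : p + m + n = m + n + p by rewrite -addrA addrC.
rewrite opprD [X in X + _]addrACA [LHS]addrACA -!scalerDl -scalerBl -!intrD -intrB.
rewrite [X in X%:~R *: _](_ : _ = 0) ?scale0r ?add0r; last first.
  by rewrite /gdet /=; ring.
case: ifP => [/eqP mnp|_]; last by rewrite subr0 addr0.
have -> : p = - (m + n) by apply/eqP; rewrite -addr_eq0 addrC mnp.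
by rewrite -scaleNr -mulrNz; apply: LhZ3; rewrite /gdet /=; ring.
Qed.

Lemma jac_EEE m n p : jac (LE m) (LE n) (LE p) = 0.
Proof.
rewrite /jac !Lbracket_EEE.
have -> : n + p + m = m + n + p by rewrite addrC addrA.
have -> : p + m + n = m + n + p by rewrite -addrA addrC.
rewrite [X in X + _]addrACA [LHS]addrACA -!scalerDl -!intrD.
rewrite [X in X%:~R *: _](_ : _ = 0) ?scale0r ?add0r; last first.
  by rewrite /gdet /=; ring.
case: ifP => [/eqP mnp|_]; last by rewrite !addr0.
have -> : p = - (m + n) by apply/eqP; rewrite -addr_eq0 addrC mnp.
by apply: LfZ3; rewrite /gdet /=; ring.
Qed.

Lemma jac_dtt i m n : jac (Ld i) (Lt m) (Lt n) = 0.
Proof.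
rewrite /jac Lbracket_tt [Lbracket (Lt n) _]LbracketC LbracketNr.
by rewrite !Lbracket_dt !LbracketZr !Lbracket_tt Lbracket0r !scaler0 oppr0 !addr0.
Qed.

Lemma Lbracket_dh i (b : bool) m : Lbracket (Ld i) (if b then Lh m else 0) = 0.
Proof. by case: b; rewrite ?Lbracket0r ?Lbracket_hr. Qed.

Lemma Lbracket_df i (b : bool) m : Lbracket (Ld i) (if b then Lf m else 0) = 0.
Proof. by case: b; rewrite ?Lbracket0r ?Lbracket_fr. Qed.

Lemma gcoordD i m n : gcoord i (m + n) = gcoord i m + gcoord i n.
Proof. by rewrite /gcoord; case: ifP. Qed.

Lemma gcoord_eq0 i m n : m + n == 0 -> gcoord i m = - gcoord i n.
Proof.
move=> /eqP mn; apply/eqP; rewrite -addr_eq0 -gcoordD mn.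
by rewrite /gcoord; case: ifP.
Qed.

Lemma jac_dtE i m n : jac (Ld i) (Lt m) (LE n) = 0.
Proof.
rewrite /jac [Lbracket (LE n) (Ld i)]LbracketC LbracketNr Lbracket_dE.
rewrite Lbracket_dt !LbracketZr [Lbracket (LE n) _]LbracketC.
rewrite {1}Lbracket_tE LbracketDr LbracketZr Lbracket_dt Lbracket_dh addr0.
rewrite Lbracket_tE scalerN -addrA -opprD -scalerDl -intrD scalerDr.
rewrite [gcoord i n + _]addrC -gcoordD !scalerA [_ * (gcoord _ _)%:~R]mulrC.
rewrite opprD addrA subrr sub0r; case: ifP => [/eqP ->|_]; rewrite ?scaler0 ?oppr0 //.
by rewrite /gcoord if_same scale0r oppr0.
Qed.

Lemma jac_dEE i m n : jac (Ld i) (LE m) (LE n) = 0.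
Proof.
rewrite /jac [Lbracket (LE n) (Ld i)]LbracketC LbracketNr.
rewrite !Lbracket_dE !LbracketZr [Lbracket (LE n) _]LbracketC.
rewrite {1}Lbracket_EE LbracketDr LbracketZr Lbracket_dE Lbracket_df addr0.
rewrite Lbracket_EE scalerN -addrA -opprD -scalerDl -intrD scalerDr.
rewrite [gcoord i n + _]addrC -gcoordD !scalerA [_ * (gcoord _ _)%:~R]mulrC.
rewrite opprD addrA subrr sub0r; case: ifP => [/eqP ->|_]; rewrite ?scaler0 ?oppr0 //.
by rewrite /gcoord if_same scale0r oppr0.
Qed.

Lemma jac_ddt i j m : jac (Ld i) (Ld j) (Lt m) = 0.
Proof.
rewrite /jac Lbracket_dd Lbracket0r addr0 [Lbracket (Lt m) _]LbracketC LbracketNr.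
by rewrite !(Lbracket_dt, LbracketZr) !scalerA mulrC subrr.
Qed.

Lemma jac_ddE i j m : jac (Ld i) (Ld j) (LE m) = 0.
Proof.
rewrite /jac Lbracket_dd Lbracket0r addr0 [Lbracket (LE m) _]LbracketC LbracketNr.
by rewrite !(Lbracket_dE, LbracketZr) !scalerA mulrC subrr.
Qed.

Lemma jac_ddd i j k : jac (Ld i) (Ld j) (Ld k) = 0.
Proof. by rewrite /jac !Lbracket_dd !Lbracket0r !addr0. Qed.

Lemma LtU (m : nzGamma) : Lbase (Bt m) = Lt (val m).
Proof. by rewrite /Lt valK. Qed.

Lemma LEU (m : nzGamma) : Lbase (BE m) = LE (val m).
Proof. by rewrite /LE valK. Qed.

Lemma LKU j : Lbase (BK j) = LK j.
Proof. by []. Qed.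

Lemma LdU i : Lbase (Bd i) = Ld i.
Proof. by []. Qed.

(* Matching on the syntax of the goal, since a failing conversion between two
   instances of jac is very slow. *)
Ltac jac_cases := lazymatch goal with
  | |- jac (LK _) _ _ = _ => apply: jac_K
  | |- jac (Lt _) (Lt _) (Lt _) = _ => apply: jac_ttt
  | |- jac (LE _) (Lt _) (Lt _) = _ => apply: jac_Ett
  | |- jac (Lt _) (LE _) (LE _) = _ => apply: jac_tEE
  | |- jac (LE _) (LE _) (LE _) = _ => apply: jac_EEE
  | |- jac (Ld _) (Lt _) (Lt _) = _ => apply: jac_dtt
  | |- jac (Ld _) (Lt _) (LE _) = _ => apply: jac_dtE
  | |- jac (Ld _) (LE _) (Lt _) = _ =>
      rewrite jac_rot jac_swap -jac_rot jac_dtE; exact: oppr0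
  | |- jac (Ld _) (LE _) (LE _) = _ => apply: jac_dEE
  | |- jac (Ld _) (Ld _) (Lt _) = _ => apply: jac_ddt
  | |- jac (Ld _) (Ld _) (LE _) = _ => apply: jac_ddE
  | |- jac (Ld _) (Ld _) (Ld _) = _ => apply: jac_ddd
  | |- _ => rewrite jac_rot; jac_cases
  end.

Lemma jac_basis i j k : jac (Lbase i) (Lbase j) (Lbase k) = 0.
Proof.
case: i j k => [m|m|a|a] [n|n|b|b] [p|p|c|c];
  rewrite ?LtU ?LEU ?LKU ?LdU; jac_cases.
Qed.

Lemma jac_eq0 x y z : jac x y z = 0.
Proof.
elim/Ltilde_ind: x => [|x x' Hx Hx'|a i].
- by rewrite /jac !(Lbracket0l, Lbracket0r) !addr0.
- have -> : jac (x + x') y z = jac x y z + jac x' y z.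
    by rewrite /jac !(LbracketDl, LbracketDr) [X in X + _ = _]addrACA [LHS]addrACA.
  by rewrite Hx Hx' addr0.
have -> : jac (a *: (Lbase i)) y z = a *: jac (Lbase i) y z.
  by rewrite /jac !(LbracketZl, LbracketZr) !scalerDr.
rewrite jac_rot; elim/Ltilde_ind: y => [|y y' Hy Hy'|b j].
- by rewrite /jac !(Lbracket0l, Lbracket0r) !addr0 scaler0.
- have -> : jac (y + y') z (Lbase i) = jac y z (Lbase i) + jac y' z (Lbase i).
    by rewrite /jac !(LbracketDl, LbracketDr) [X in X + _ = _]addrACA [LHS]addrACA.
  by rewrite scalerDr Hy Hy' addr0.
have -> : jac (b *: (Lbase j)) z (Lbase i) = b *: jac (Lbase j) z (Lbase i).
  by rewrite /jac !(LbracketZl, LbracketZr) !scalerDr.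
rewrite jac_rot; elim/Ltilde_ind: z => [|z z' Hz Hz'|c k].
- by rewrite /jac !(Lbracket0l, Lbracket0r) !addr0 !scaler0.
- have -> : jac (z + z') (Lbase i) (Lbase j) = jac z (Lbase i) (Lbase j) + jac z' (Lbase i) (Lbase j).
    by rewrite /jac !(LbracketDl, LbracketDr) [X in X + _ = _]addrACA [LHS]addrACA.
  by rewrite 2!scalerDr Hz Hz' addr0.
have -> : jac (c *: (Lbase k)) (Lbase i) (Lbase j) = c *: jac (Lbase k) (Lbase i) (Lbase j).
  by rewrite /jac !(LbracketZl, LbracketZr) !scalerDr.
by rewrite jac_basis !scaler0.
Qed.

End LtildeBracket.

HB.instance Definition _ (F : fieldType) := isLieAlgebra.Build F (Ltilde F)
  (@Lbracket_alt F) (@jac_eq0 F).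

Section WeightModules.
Variables (F : fieldType) (V : lmodType F) (rho : lie_module (Ltilde F) V).

(* The first two coordinates of a weight are the eigenvalues of d_1, d_2 and
   the last four those of K_1, ..., K_4. *)
Definition weight_space (lam : 'rV[F]_(2 + 4)) : set V :=
  [set v | (forall i : 'I_2, rho (Ld F i) v = lam 0 (lshift 4 i) *: v) /\
           (forall j : 'I_4, rho (LK F j) v = lam 0 (rshift 2 j) *: v)].

(* V is the direct sum of its weight spaces: they span V and are independent. *)
Definition weight_module : Prop :=
  (forall v : V, exists (s : seq 'rV[F]_(2 + 4)) (w : 'rV[F]_(2 + 4) -> V),
     [/\ uniq s, forall lam, weight_space lam (w lam) & v = \sum_(lam <- s) w lam]) /\
  (forall (s : seq 'rV[F]_(2 + 4)) (w : 'rV[F]_(2 + 4) -> V),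
     uniq s -> (forall lam, weight_space lam (w lam)) ->
     \sum_(lam <- s) w lam = 0 -> forall lam, lam \in s -> w lam = 0).

Definition submodule (W : set V) : Prop :=
  [/\ W 0, forall a u v, W u -> W v -> W (a *: u + v) & forall x v, W v -> W (rho x v)].

Definition irreducible : Prop :=
  (exists v : V, v != 0) /\
  (forall W : set V, submodule W -> W = [set 0] \/ W = [set: V]).

Definition has_dim (W : set V) (n : nat) : Prop :=
  exists b : 'I_n -> V,
    [/\ forall i, W (b i),
        forall c : 'I_n -> F, \sum_i c i *: b i = 0 -> forall i, c i = 0
      & forall w, W w -> exists c : 'I_n -> F, w = \sum_i c i *: b i].

Definition harish_chandra : Prop :=
  [/\ weight_module, irreducible & forall lam, exists n, has_dim (weight_space lam) n].

Definition uniformly_bounded : Prop :=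
  weight_module /\
  exists2 N : nat, (0 < N)%N &
    forall lam, exists2 n, (n <= N)%N & has_dim (weight_space lam) n.

(* U(L) v, which is spanned by the vectors x_1 ... x_k v with the x_i in L. *)
Definition env_orbit (v : V) : set V :=
  [set u | exists s : seq (F * seq (Ltilde F)),
     u = \sum_(p <- s) p.1 *: foldr (fun x w => rho x w) v p.2].

Definition Zbasis (b1 b2 : Gamma) : Prop :=
  bijective (fun c : int * int => b1 *~ c.1 + b2 *~ c.2).

Definition ghw_module : Prop :=
  weight_module /\
  exists (b1 b2 : Gamma) (v : V),
    [/\ Zbasis b1 b2, v != 0, exists lam, weight_space lam v,
        env_orbit v = [set: V]
      & forall k l : nat, rho (LE F (b1 *+ k + b2 *+ l)) v = 0 /\
                          rho (Lt F (b1 *+ k + b2 *+ l)) v = 0].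

End WeightModules.

(* Main.v *)
(* Fix a weight mu of V. If V is not uniformly bounded, some weight space
   V_(mu - m) has dimension larger than the sum of those of all the spaces
   V_(mu + s), with s in a fixed finite box of Gamma, each counted twice; hence
   some nonzero v in V_(mu - m) is killed by E(m + s) and t^(m + s) for all s in
   the box. The set A of degrees n such that E(n) v = t^n v = 0 is closed under
   sums of linearly independent elements. Since the box surrounds m (up to a
   shift avoiding the coordinate axes), adding the elements m + s to one another
   shows that T m + s is in A for every s and all large T. In particular A
   contains x = T m + q and x + p, where m is a multiple of p and (p, q) is a
   Z-basis; the Z-basis (x, x + p) then yields a cone of annihilating degrees. *)
Require Import Defs.
From mathcomp Require Import all_boot all_order all_algebra.
From mathcomp Require Import complex reals.
From mathcomp Require Import boolp classical_sets ring zify.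

Set Implicit Arguments.
Unset Strict Implicit.
Unset Printing Implicit Defensive.

Import Order.TTheory GRing.Theory Num.Theory.
Local Open Scope ring_scope.

(** * Determinants and bases of the lattice *)

Lemma gdetDl a b c : gdet (a + b) c = gdet a c + gdet b c.
Proof. by rewrite /gdet /=; ring. Qed.

Lemma gdetDr a b c : gdet a (b + c) = gdet a b + gdet a c.
Proof. by rewrite /gdet /=; ring. Qed.

Lemma gdetMnl a b n : gdet (a *+ n) b = gdet a b *+ n.
Proof. by elim: n => [|n IH]; rewrite ?gdet0l // !mulrS gdetDl IH. Qed.

Lemma gdetMnr a b n : gdet a (b *+ n) = gdet a b *+ n.
Proof. by rewrite gdetC gdetMnl gdetC mulNrn opprK. Qed.

Lemma gdetxx a : gdet a a = 0.
Proof. by rewrite /gdet mulrC subrr. Qed.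

Lemma gamma_mulzE (a : Gamma) (n : int) : a *~ n = (a.1 * n, a.2 * n).
Proof.
have H k : a *+ k = (a.1 * k%:Z, a.2 * k%:Z).
  elim: k => [|k IH]; first by rewrite !mulr0.
  by rewrite mulrS IH; congr (_, _) => /=; rewrite -addn1 PoszD; ring.
case: n => n; first exact: H.
by rewrite NegzE mulrNz; change (- (a *+ n.+1) = (a.1 * - n.+1%:Z, a.2 * - n.+1%:Z));
  rewrite H !mulrN.
Qed.

Lemma Zbasis_gdet1 b1 b2 : gdet b1 b2 = 1 -> Zbasis b1 b2.
Proof.
(* Cramer's rule gives the inverse. *)
move=> det1; exists (fun p => (gdet p b2, gdet b1 p)) => [[k l]|p] /=.
  rewrite !gamma_mulzE /gdet /=; congr (_, _).
  - by rewrite -[RHS]mul1r -det1 /gdet; ring.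
  - by rewrite -[RHS]mul1r -det1 /gdet; ring.
rewrite !gamma_mulzE [RHS]surjective_pairing; congr (_, _) => /=.
- by rewrite -[RHS]mul1r -det1 /gdet; ring.
- by rewrite -[RHS]mul1r -det1 /gdet; ring.
Qed.

Lemma exists_primitive (m : Gamma) : m != 0 ->
  exists (p q : Gamma) (d : int), m = p *~ d /\ gdet p q = 1.
Proof.
move=> m0; have [u [v uv]] := Bezoutz m.1 m.2.
set g := gcdz m.1 m.2 in uv.
have g0 : g != 0.
  by rewrite gcdz_eq0; apply: contra m0 => /andP[/eqP e1 /eqP e2]; rewrite [m]surjective_pairing e1 e2.
have e1 : m.1 = (m.1 %/ g)%Z * g by rewrite divzK // dvdz_gcdl.
have e2 : m.2 = (m.2 %/ g)%Z * g by rewrite divzK // dvdz_gcdr.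
(* With [q = (- v, u)], the product [gdet p q * g] is the Bezout combination of [m.1] and [m.2],
   which equals [g]. *)
exists ((m.1 %/ g)%Z, (m.2 %/ g)%Z), (- v, u), g.
rewrite gamma_mulzE /= -e1 -e2 -surjective_pairing; split=> //.
apply: (mulIf g0); rewrite mul1r -[RHS]uv [in RHS]e1 [in RHS]e2 /gdet /=; ring.
Qed.

(** * Sets of degrees closed under independent sums *)

Section DetClosed.
Variable A : Gamma -> Prop.
Hypothesis A_add : forall n n', A n -> A n' -> gdet n n' != 0 -> A (n + n').

(** Adding further copies of [g], then of [g'], keeps the two summands independent as long as the
    other generator is present; hence the positive coefficients. *)
Lemma det_closed_comb g g' (a b : nat) : A g -> A g' -> gdet g g' != 0 ->
  A (g *+ a.+1 + g' *+ b.+1).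
Proof.
move=> Ag Ag' d.
have H k : A (g *+ k.+1 + g').
  elim: k => [|k IH]; first exact: A_add.
  rewrite mulrS -addrA; apply: A_add => //.
  by rewrite gdetDr gdetMnr gdetxx mul0rn add0r.
elim: b => [|b IH]; first exact: H.
rewrite [g' *+ _]mulrSr addrA; apply: A_add => //.
by rewrite gdetDl !gdetMnl gdetxx mul0rn addr0 mulrn_eq0.
Qed.

(** The determinant of [m *+ T + s] and [g] is [gdet m g *+ T + gdet s g], nonzero once [T] exceeds
    the absolute value of [gdet s g]. *)
Lemma det_closed_step (m g s : Gamma) : A g -> gdet m g != 0 ->
  (exists T0, forall T, (T0 <= T)%N -> A (m *+ T + s)) ->
  exists T0, forall T, (T0 <= T)%N -> A (m *+ T + (s + (g - m))).
Proof.
move=> Ag d [T0 HT]; exists (T0 + `|gdet s g|%N).+2 => -[//|T] leT.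
have -> : m *+ T.+1 + (s + (g - m)) = (m *+ T + s) + g.
  by rewrite mulrSr; ring.
apply: A_add => //; first by apply: HT; lia.
rewrite gdetDl gdetMnl; have : (`|gdet s g| < T)%N by lia.
by rewrite -mulr_natr; nia.
Qed.

(** Unit moves reach every [s]; as both coordinates of [m] are nonzero, each unit vector is
    independent of [m]. *)
Lemma det_closed_absorb (m : Gamma) :
  A m -> A (m + (1, 0)) -> A (m + (-1, 0)) -> A (m + (0, 1)) -> A (m + (0, -1)) ->
  m.1 != 0 -> m.2 != 0 ->
  forall s, exists T0, forall T, (T0 <= T)%N -> A (m *+ T + s).
Proof.
move=> Am Ar Al Au Ad m1 m2.
have step g s : A (m + g) -> gdet m g != 0 ->
    (exists T0, forall T, (T0 <= T)%N -> A (m *+ T + s)) ->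
    exists T0, forall T, (T0 <= T)%N -> A (m *+ T + (s + g)).
  move=> Ag d Hs; have := @det_closed_step m (m + g) s Ag.
  by rewrite gdetDr gdetxx add0r => /(_ d Hs); rewrite [m + g - m]addrAC subrr add0r.
have dr : gdet m (1, 0) != 0 by rewrite /gdet /=; lia.
have dl : gdet m (-1, 0) != 0 by rewrite /gdet /=; lia.
have du : gdet m (0, 1) != 0 by rewrite /gdet /=; lia.
have dd : gdet m (0, -1) != 0 by rewrite /gdet /=; lia.
have Q0 : exists T0, forall T, (T0 <= T)%N -> A (m *+ T + 0).
  (* Copies of [m] alone are dependent, so [m *+ T] is reached by a detour through
     [m *+ T + (1, 0)]. *)
  rewrite (_ : 0 = (1, 0) + (-1, 0)) //; apply: step => //.
  exists 2%N => -[|[|T]] // _.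
  have := @det_closed_comb m (m + (1, 0)) T 0 Am Ar.
  rewrite gdetDr gdetxx add0r => /(_ dr).
  by rewrite mulr1n addrA -mulrSr.
have Q1 (k : int) : exists T0, forall T, (T0 <= T)%N -> A (m *+ T + (k, 0)).
  elim: k => [|k IH|k IH]; first exact: Q0.
  - by have := step _ _ Ar dr IH; rewrite [(_, _) + _](_ : _ = (k.+1%:Z, 0)) //;
      congr (_, _) => /=; lia.
  - by have := step _ _ Al dl IH; rewrite [(_, _) + _](_ : _ = (- k.+1%:Z, 0)) //;
      congr (_, _) => /=; lia.
case=> k; elim=> [|l IH|l IH]; first exact: Q1.
- by have := step _ _ Au du IH; rewrite [(_, _) + _](_ : _ = (k, l.+1%:Z)) //;
    congr (_, _) => /=; lia.
- by have := step _ _ Ad dd IH; rewrite [(_, _) + _](_ : _ = (k, - l.+1%:Z)) //;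
    congr (_, _) => /=; lia.
Qed.

Lemma det_closed_basis (m : Gamma) :
  A m -> A (m + (1, 0)) -> A (m + (-1, 0)) -> A (m + (0, 1)) -> A (m + (0, -1)) ->
  m.1 != 0 -> m.2 != 0 ->
  exists x y, [/\ A x, A y & gdet x y = 1].
Proof.
move=> Am Ar Al Au Ad m1 m2.
have H := det_closed_absorb Am Ar Al Au Ad m1 m2.
have m0 : m != 0 by apply: contra m1 => /eqP ->.
have [p [q [d [mE pq]]]] := exists_primitive m0.
have [T1 H1] := H q; have [T2 H2] := H (q + p).
(* The two vectors differ by [p], and [m] is a multiple of [p], so their determinant reduces to
   [gdet p q = 1]. *)
exists (m *+ (T1 + T2) + (q + p)), (m *+ (T1 + T2) + q).
split; [by apply: H2; lia|by apply: H1; lia|].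
rewrite addrA gdetDl gdetxx add0r gdetDr gdetMnr pq mE gamma_mulzE /gdet /=.
by rewrite !mulrA [p.1 * p.2]mulrC subrr mul0rn add0r.
Qed.

(* The basis x + y, x + 2y lies in the open cone spanned by x and y, which
   avoids the multiples of x and y themselves. *)
Lemma det_closed_cone (x y : Gamma) : A 0 -> A x -> A y -> gdet x y = 1 ->
  exists b1 b2, Zbasis b1 b2 /\ forall k l : nat, A (b1 *+ k + b2 *+ l).
Proof.
move=> A0 Ax Ay xy; exists (x + y), (x + y *+ 2); split.
  apply: Zbasis_gdet1; rewrite gdetDl !gdetDr !gdetxx xy [gdet y x]gdetC xy.
  by lia.
move=> k l; have -> : (x + y) *+ k + (x + y *+ 2) *+ l = x *+ (k + l) + y *+ (k + 2 * l).
  by rewrite mulrnDl [X in _ + X]mulrnDl -mulrnA addrACA -!mulrnDr.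
(* Only [k = l = 0] uses [A 0]; otherwise both coefficients are positive. *)
case: k l => [|k] [|l]; first by rewrite !mulr0n addr0.
- by rewrite add0n add0n mulnS !addSn; apply: det_closed_comb; rewrite ?xy.
- by rewrite !addSn; apply: det_closed_comb; rewrite ?xy.
- by rewrite !addSn; apply: det_closed_comb; rewrite ?xy.
Qed.

End DetClosed.

(** * Weights and their cosets modulo the lattice *)

Section WeightTheory.
Variables (F : numFieldType) (V : lmodType F) (rho : lie_module (Ltilde F) V).
Local Notation wt := 'rV[F]_(2 + 4).
Local Notation wspace := (weight_space rho).

(** The last four coordinates stay fixed because the [K_j] are central. *)
Definition gshift (g : Gamma) : wt :=
  row_mx (\row_(i < 2) (gcoord i g)%:~R) 0.

Lemma gshiftD g g' : gshift (g + g') = gshift g + gshift g'.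
Proof.
rewrite /gshift add_row_mx addr0; congr row_mx.
by apply/rowP => i; rewrite !mxE gcoordD intrD.
Qed.

Lemma gshift0 : gshift 0 = 0.
Proof.
rewrite /gshift -[RHS]row_mx0; congr row_mx; apply/rowP => i; rewrite !mxE.
by rewrite /gcoord if_same.
Qed.

Lemma act_comm x y v :
  rho x (rho y v) = rho (Lbracket x y) v + rho y (rho x v).
Proof. by have -> := act_bracket rho x y v; rewrite subrK. Qed.

Lemma weight_space0 lam : wspace lam 0.
Proof. by split=> i; rewrite linear0r scaler0. Qed.

Lemma weight_spaceP lam a u v : wspace lam u -> wspace lam v -> wspace lam (a *: u + v).
Proof.
move=> [u1 u2] [v1 v2]; split=> i.
- by rewrite linearDr linearZr_LR u1 v1 scalerDr !scalerA mulrC.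
- by rewrite linearDr linearZr_LR u2 v2 scalerDr !scalerA mulrC.
Qed.

Lemma act_weight (x : Ltilde F) g lam v :
  (forall i, Lbracket (Ld F i) x = (gcoord i g)%:~R *: x) ->
  wspace lam v -> wspace (lam + gshift g) (rho x v).
Proof.
move=> hx [v1 v2]; split=> i.
- rewrite act_comm hx v1 linearZl_LR linearZr_LR -scalerDl; congr (_ *: _).
  by rewrite !mxE (unsplitK (inl i)) mxE addrC.
- rewrite act_comm Lbracket_Kl linear0l add0r v2 linearZr_LR; congr (_ *: _).
  by rewrite !mxE (unsplitK (inr i)) mxE addr0.
Qed.

Definition basis_deg (k : ltilde_basis) : Gamma :=
  match k with Bt m => val m | BE m => val m | _ => 0 end.

Lemma act_basis_weight k lam v :
  wspace lam v -> wspace (lam + gshift (basis_deg k)) (rho (Lbase F k) v).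
Proof.
apply: act_weight => i; case: k => [m|m|j|j] /=.
- by rewrite LtU Lbracket_dt.
- by rewrite LEU Lbracket_dE.
- by rewrite LKU Lbracket_Kr /gcoord if_same scale0r.
- by rewrite LdU Lbracket_dd /gcoord if_same scale0r.
Qed.

Lemma env_orbit_submodule v : submodule rho (env_orbit rho v).
Proof.
split.
- by exists [::]; rewrite big_nil.
- move=> a _ _ [s ->] [s' ->].
  exists ([seq (a * p.1, p.2) | p <- s] ++ s'); rewrite big_cat big_map /=.
  by congr (_ + _); rewrite scaler_sumr; apply: eq_bigr => p _; rewrite scalerA.
- move=> x _ [s ->]; exists [seq (p.1, x :: p.2) | p <- s].
  by rewrite big_map linear_sumr; apply: eq_bigr => p _; rewrite linearZr_LR.
Qed.

Lemma env_orbit_self v : env_orbit rho v v.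
Proof. by exists [:: (1, [::])]; rewrite big_seq1 scale1r. Qed.

(** Degrees may repeat in the list, so that addition is concatenation. *)
Definition coset_sum (lam : wt) : set V := [set u | exists s : seq (Gamma * V),
  (forall p, p \in s -> wspace (lam + gshift p.1) p.2) /\ u = \sum_(p <- s) p.2].

Lemma coset_sumP lam a u v :
  coset_sum lam u -> coset_sum lam v -> coset_sum lam (a *: u + v).
Proof.
move=> [s [sP ->]] [s' [s'P ->]]; exists ([seq (p.1, a *: p.2) | p <- s] ++ s').
split; last by rewrite big_cat big_map scaler_sumr.
move=> p; rewrite mem_cat => /orP[/mapP[q qs ->]|]; last exact: s'P.
by rewrite -[_ *: _]addr0; apply: weight_spaceP (sP _ qs) (weight_space0 _).
Qed.

Lemma coset_sum0 lam : coset_sum lam 0.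
Proof. by exists [::]; rewrite big_nil. Qed.

Lemma coset_sum_submodule lam : submodule rho (coset_sum lam).
Proof.
split; [exact: coset_sum0|exact: coset_sumP|].
move=> x _ [s [sP ->]]; elim/Ltilde_ind: x => [|x y Hx Hy|a k].
- by rewrite linear0l; exact: coset_sum0.
- by rewrite linearDl -[rho x _]scale1r; exact: coset_sumP.
rewrite linearZl_LR -[_ *: _]addr0; apply: coset_sumP (coset_sum0 _).
exists [seq (p.1 + basis_deg k, rho (Lbase F k) p.2) | p <- s].
split; last by rewrite big_map linear_sumr.
move=> _ /mapP[p ps ->] /=; rewrite gshiftD addrA.
exact: act_basis_weight (sP _ ps).
Qed.

Lemma weight_sum_disjoint nu w (s : seq (wt * V)) : weight_module rho ->
  wspace nu w -> (forall p, p \in s -> wspace p.1 p.2) ->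
  nu \notin [seq p.1 | p <- s] -> w = \sum_(p <- s) p.2 -> w = 0.
Proof.
move=> [_ indep] wnu sP nuNs wE.
(* Independence concerns distinct weights: vectors of equal weight are grouped, and [- w] is placed
   at [nu] to make the total vanish. *)
pose f mu := if mu == nu then - w else \sum_(p <- s | p.1 == mu) p.2.
pose r := undup [seq p.1 | p <- s].
have fP mu : wspace mu (f mu).
  rewrite /f; case: eqP => [->|_].
    by rewrite -scaleN1r -[_ *: _]addr0; apply: weight_spaceP (weight_space0 _).
  rewrite big_seq_cond; apply: big_ind => [|u v Hu Hv|p /andP[ps /eqP <-]].
  - exact: weight_space0.
  - by rewrite -[u]scale1r; apply: weight_spaceP.
  - exact: sP.
have uniq_r : uniq (nu :: r) by rewrite /= mem_undup nuNs undup_uniq.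
have sum0 : \sum_(mu <- nu :: r) f mu = 0.
  rewrite big_cons {1}/f eqxx wE; apply/eqP; rewrite addrC subr_eq0; apply/eqP.
  transitivity (\sum_(mu <- r) \sum_(p <- s | p.1 == mu) p.2).
    apply: eq_big_seq => mu; rewrite mem_undup /f => mus; case: eqP => // munu.
    by rewrite munu (negbTE nuNs) in mus.
  under eq_bigr do rewrite big_mkcond.
  rewrite exchange_big /=; apply: eq_big_seq => p ps.
  rewrite (bigD1_seq p.1) ?undup_uniq ?mem_undup ?map_f //= eqxx big1 ?addr0 //.
  by move=> mu; rewrite eq_sym => /negbTE ->.
have := indep _ _ uniq_r fP sum0 nu (mem_head _ _).
by rewrite /f eqxx => /eqP; rewrite oppr_eq0 => /eqP.
Qed.

(** By irreducibility the nonzero submodule [coset_sum lam] is all of [V], and independence of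
    weight spaces excludes weights outside the coset. *)
Lemma weight_coset lam v nu w : weight_module rho -> irreducible rho ->
  wspace lam v -> v != 0 -> wspace nu w -> w != 0 ->
  exists g, nu = lam + gshift g.
Proof.
move=> wm [_ irr] vlam v0 wnu w0; apply: contrapT => Hn.
have [W0|WT] := irr _ (coset_sum_submodule lam).
  have : coset_sum lam v.
    exists [:: (0, v)]; rewrite big_seq1; split=> // p.
    by rewrite inE => /eqP ->; rewrite gshift0 addr0.
  by rewrite W0 => /= /eqP; rewrite (negbTE v0).
have : coset_sum lam w by rewrite WT.
move=> [s [sP wE]]; case/eqP: w0.
apply: (@weight_sum_disjoint nu w [seq (lam + gshift p.1, p.2) | p <- s]) => //.
- by move=> _ /mapP[p ps ->]; exact: sP.
- rewrite -map_comp; apply/negP => /mapP[p _ nuE]; apply: Hn.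
  by exists p.1.
- by rewrite big_map.
Qed.

(** * Annihilating degrees and dimension count *)

Definition annihilates v g := rho (LE F g) v = 0 /\ rho (Lt F g) v = 0.

Lemma annihilates0 v : annihilates v 0.
Proof. by split; rewrite ?LE0 ?Lt0 linear0l. Qed.

(** Independence forces [n + n'] to be nonzero, so the brackets have no central term, and their
    determinant coefficient is invertible in characteristic zero. *)
Lemma annihilates_add v n n' :
  annihilates v n -> annihilates v n' -> gdet n n' != 0 -> annihilates v (n + n').
Proof.
move=> [En tn] [En' tn'] d.
have nn' : (n + n' == 0) = false.
  apply: contra_neqF d => /eqP; rewrite addrC => /(canRL (addrK _)) ->.
  by rewrite sub0r /gdet /=; ring.
have d' : (gdet n' n)%:~R != 0 :> F by rewrite intr_eq0 gdetC oppr_eq0.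
split; apply: (scalerI d'); rewrite scaler0 -linearZl_LR.
- have := Lbracket_EE F n n'; rewrite nn' addr0 => <-.
  by have -> := act_bracket rho (LE F n) (LE F n') v; rewrite En En' !linear0r subrr.
- have := Lbracket_tE F n n'; rewrite nn' addr0 => <-.
  by have -> := act_bracket rho (Lt F n) (LE F n') v; rewrite tn En' !linear0r subrr.
Qed.

(** Each operator imposes at most [dims x] linear conditions on the coefficients; the rows of [K]
    span solutions of all of them. *)
Lemma common_kernel n (b : 'I_n -> V) (I : eqType) (xs : seq I) (X : I -> Ltilde F)
    (tgt : I -> set V) (dims : I -> nat) :
  (forall x, x \in xs -> has_dim (tgt x) (dims x)) ->
  (forall x i, x \in xs -> tgt x (rho (X x) (b i))) ->
  exists K : 'M[F]_n, (n <= \rank K + \sum_(x <- xs) dims x)%N /\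
    forall c : 'rV_n, (c <= K)%MS ->
      forall x, x \in xs -> rho (X x) (\sum_i c 0 i *: b i) = 0.
Proof.
elim: xs => [|x xs IH] hdim htgt.
  by exists 1%:M; rewrite mxrank1 leq_addr.
have [||K [rK KP]] := IH.
- by move=> y ys; apply: hdim; rewrite inE ys orbT.
- by move=> y i ys; apply: htgt; rewrite inE ys orbT.
have [e [_ _ espan]] := hdim x (mem_head _ _).
have /choice[f fP] i := espan _ (htgt x i (mem_head _ _)).
(* [M] holds the coordinates of the images of the [b i] along [e]; meeting its left kernel lowers
   the rank by at most [\rank M]. *)
pose M := \matrix_(i, j) f i j.
exists (K :&: kermx M)%MS; split.
  rewrite big_cons; have := mxrank_sum_cap K (kermx M).
  have := rank_leq_col (K + kermx M)%MS; have := rank_leq_col M.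
  have := rank_leq_row M.
  by rewrite mxrank_ker; move: rK; set a := \rank K; set z := \rank M;
    set u := \rank _; set t := \rank _; set S := bigop _ _ _; lia.
move=> c; rewrite sub_capmx => /andP[cK /sub_kermxP cM] y.
rewrite inE => /orP[/eqP ->|]; last exact: KP.
rewrite linear_sumr.
under eq_bigr do rewrite linearZr_LR fP scaler_sumr.
rewrite exchange_big big1 // => j _.
under eq_bigr do rewrite scalerA.
rewrite -scaler_suml.
have /matrixP/(_ 0 j) := cM; rewrite !mxE => cM0.
rewrite (eq_bigr (fun i => c 0 i * M i j)) => [|i _]; last by rewrite mxE.
by rewrite cM0 scale0r.
Qed.

Lemma annihilated_vector nu n (S : seq Gamma) (dims : Gamma -> nat) :
  has_dim (wspace nu) n ->
  (forall g, has_dim (wspace (nu + gshift g)) (dims g)) ->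
  (\sum_(g <- S) dims g + \sum_(g <- S) dims g < n)%N ->
  exists v, [/\ v != 0, wspace nu v & forall g, g \in S -> annihilates v g].
Proof.
move=> [b [bnu bfree _]] hdim lt_n.
(* The tag chooses between [E] and [t], so every dimension counts twice. *)
pose X (p : bool * Gamma) := if p.1 then LE F p.2 else Lt F p.2.
have [||K [rK KP]] := @common_kernel n b (bool * Gamma)%type
  ([seq (true, g) | g <- S] ++ [seq (false, g) | g <- S]) X
  (fun p => wspace (nu + gshift p.2)) (fun p => dims p.2).
- by move=> [c g] _; exact: hdim.
- move=> [c g] i _; apply: act_weight => // j; rewrite /X /=.
  by case: c; rewrite ?Lbracket_dE ?Lbracket_dt.
have K0 : K != 0.
  rewrite -mxrank_eq0 -lt0n; move: rK; rewrite big_cat !big_map /=.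
  by set s := bigop _ _ _ in lt_n *; set r := \rank K; lia.
have /rowV0Pn[c cK c0] := K0.
exists (\sum_i c 0 i *: b i); split.
- by apply: contra c0 => /eqP /bfree c0; apply/eqP/rowP => i; rewrite mxE c0.
- by apply: big_ind => [|x y Hx Hy|i _];
    [exact: weight_space0 | rewrite -[x]scale1r; exact: weight_spaceP
    | rewrite -[_ *: _]addr0; exact: weight_spaceP (weight_space0 _)].
- move=> g gS; split.
  + by have /= -> // := KP c cK (true, g); rewrite mem_cat map_f.
  + by have /= -> // := KP c cK (false, g); rewrite mem_cat map_f ?orbT.
Qed.

(** * From an annihilated box to the dichotomy *)

Lemma ghw_of_annihilated_box lam v (m : Gamma) : harish_chandra rho ->
  wspace lam v -> v != 0 ->
  (forall i j : int, -1 <= i <= 2 -> -1 <= j <= 2 -> annihilates v (m + (i, j))) ->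
  ghw_module rho.
Proof.
move=> [wm [_ irr] _] vlam v0 ann.
have add := @annihilates_add v.
(* Zero coordinates of [m] are moved to 1; this shift is why the box extends to 2 on one side. *)
pose eps (k : int) : int := (k == 0)%:Z.
pose m' := m + (eps m.1, eps m.2).
have ann' (i j : int) : -1 <= i <= 1 -> -1 <= j <= 1 -> annihilates v (m' + (i, j)).
  move=> hi hj; rewrite -addrA; apply: ann => /=.
  - by rewrite /eps; case: eqP; lia.
  - by rewrite /eps; case: eqP; lia.
have [|||x [y [Ax Ay xy]]] := @det_closed_basis (annihilates v) add m' _
  (ann' 1 0 isT isT) (ann' (-1) 0 isT isT) (ann' 0 1 isT isT) (ann' 0 (-1) isT isT).
- by rewrite -[m']addr0; apply: ann'.
- by rewrite /m' /eps /=; case: eqP; lia.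
- by rewrite /m' /eps /=; case: eqP; lia.
have [b1 [b2 [Zb cone]]] := det_closed_cone add (annihilates0 v) Ax Ay xy.
split=> //; exists b1, b2, v; split=> //; first by exists lam.
have [W0|//] := irr _ (env_orbit_submodule v).
have := env_orbit_self v; rewrite W0 => /= /eqP.
by rewrite (negbTE v0).
Qed.

Theorem harish_chandra_ghw_or_bounded :
  harish_chandra rho -> ghw_module rho \/ uniformly_bounded rho.
Proof.
move=> hc; have [wm [[v0 v0n0] irr] fd] := hc.
have [mu [u [umu u0]]] : exists mu u, wspace mu u /\ u != 0.
  have [s [w [_ wP vE]]] := wm.1 v0.
  apply: contrapT => Hn; case/eqP: v0n0; rewrite vE big1 // => mu _.
  by apply: contrapT => /eqP w0; apply: Hn; exists mu, (w mu).
have /choice[D DP] g := fd (mu + gshift g).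
pose I := [:: -1; 0; 1; 2] : seq int.
pose S : seq Gamma := [seq (i, j) | i <- I, j <- I].
pose B := (\sum_(g <- S) D g)%N.
have [bnd|] := pselect (forall nu n, has_dim (wspace nu) n -> (n <= (B + B).+1)%N).
  right; split=> //; exists (B + B).+1 => // nu.
  by have [n hn] := fd nu; exists n => //; exact: bnd hn.
move=> /existsNP[nu /existsNP[n /not_implyP[hn /negP]]]; rewrite -ltnNge => ltn; left.
have [b [bnu bfree _]] := hn.
(* A nonzero vector of weight [nu] places [nu] in the coset of [mu]. *)
have i0 : 'I_n := Ordinal (leq_ltn_trans (leq0n _) ltn).
have bi0 : b i0 != 0.
  apply/eqP => b0; have := bfree (fun i => (i == i0)%:R).
  rewrite (bigD1 i0) //= eqxx scale1r b0 big1 => [|i /negbTE ->]; last by rewrite scale0r.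
  by rewrite addr0 => /(_ erefl i0); rewrite eqxx => /eqP; rewrite oner_eq0.
have [|h nuE] := @weight_coset mu u nu (b i0) wm _ umu u0 (bnu i0) bi0.
  by case: hc.
(* The weights [nu + gshift (g - h)] are [mu + gshift g], so the dimensions over the translated box
   still sum to [B]. *)
have [||v [vn0 vnu vS]] := @annihilated_vector nu n [seq g - h | g <- S] (fun g => D (h + g)) hn.
- by move=> g; rewrite nuE -addrA -gshiftD.
- rewrite big_map; under eq_bigr do rewrite addrC subrK.
  by rewrite -/B; exact: ltnW.
apply: (@ghw_of_annihilated_box nu v (- h)) => // i j hi hj.
have inI (k : int) : -1 <= k <= 2 -> k \in I.
  by move=> hk; rewrite !inE; lia.
by rewrite addrC; apply: vS; apply: (map_f (fun g => g - h)); apply: allpairs_f; exact: inI.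
Qed.

End WeightTheory.

Theorem proposition2p15 (R : realType) (V : lmodType R[i])
    (rho : lie_module (Ltilde R[i]) V) :
  harish_chandra rho -> ghw_module rho \/ uniformly_bounded rho.
Proof. exact: harish_chandra_ghw_or_bounded. Qed.
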